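(* $$\lim_{x\to\infty}\left(x-\Theta_{\mathrm{grp}}(E_x^{\mathrm{o}})\right)=0,$$ where $x$ ranges over the real numbers $x\ge 2$.
   Context: Let $\mathbb{T}=\mathbb{R}/\mathbb{Z}$ be the circle group. For real $x\ge 2$, the circle graph $E_x^{\mathrm{o}}$ is the infinite graph with vertex set $\mathbb{T}$ in which two distinct vertices are adjacent if and only if their distance modulo $1$ is strictly less than $1/x$ (the distance modulo $1$ of $u,v$ is the minimum of $|u'-v'|$ over real representatives $u',v'$). It is a Cayley graph on $\mathbb{T}$. The strong product $G\boxtimes H$ has vertex set $V(G)\times V(H)$, and two distinct vertices $(u,y),(v,z)$ are adjacent iff ($u=v$ or $\{u,v\}\in E(G)$) and ($y=z$ or $\{y,z\}\in E(H)$). $G^{\boxtimes n}$ is the strong product of $n$ copies of $G$; if $G$ is a Cayley graph on a group $\Gamma$, then $G^{\boxtimes n}$ is a Cayley graph on $\Gamma^n$. For a Cayley graph $H$ on a group $\Gamma$, $\alpha_{\mathrm{grp}}(H)$ is the size of the largest independent set of $H$ that is a subgroup of $\Gamma$, and $\Theta_{\mathrm{grp}}(H)=\sup_{n\ge 1}\alpha_{\mathrm{grp}}(H^{\boxtimes n})^{1/n}$. *)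

(* Defs.v *)
From HB Require Import structures.
From mathcomp Require Import all_boot all_order all_algebra.
From mathcomp Require Import generic_quotient ring_quotient.
From mathcomp Require Import all_classical all_reals all_analysis.
From mathcomp Require Import lra.

Set Implicit Arguments.
Unset Strict Implicit.
Unset Printing Implicit Defensive.

Import Order.TTheory GRing.Theory Num.Theory.
Import numFieldNormedType.Exports.

Local Open Scope classical_set_scope.
Local Open Scope ring_scope.
Local Open Scope quotient_scope.

(* A (possibly infinite) graph on V is given by its adjacency relation; all the
   relations built below are symmetric and irreflexive. *)
Definition graph (V : Type) := V -> V -> Prop.

Definition strong_prod (V W : Type) (G : graph V) (H : graph W) :
    graph (V * W) := fun a b =>
  [/\ a <> b, a.1 = b.1 \/ G a.1 b.1 & a.2 = b.2 \/ H a.2 b.2].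

Definition strong_pow (V : Type) (G : graph V) (n : nat) :
    graph {ffun 'I_n -> V} := fun a b =>
  a <> b /\ forall i, a i = b i \/ G (a i) (b i).
Arguments strong_pow {V} G n.

(* [strong_pow] is the iterated binary strong product, up to the identification
   of V^(n+1) with V * V^n. *)
Lemma strong_powS (V : Type) (G : graph V) (n : nat)
    (a b : {ffun 'I_n.+1 -> V}) :
  let split_head (c : {ffun 'I_n.+1 -> V}) :=
    (c ord0, [ffun i : 'I_n => c (lift ord0 i)]) in
  strong_pow G n.+1 a b <->
  strong_prod G (strong_pow G n) (split_head a) (split_head b).
Proof.
move=> split_head; split=> [[ab abG]|[/= ab ab0 abS]].
  split=> /=; [|exact: abG|].
  - move=> [ab0 /ffunP abS]; apply: ab; apply/ffunP => i.
    by case: (unliftP ord0 i) => [j|] -> //; have := abS j; rewrite !ffunE.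
  - have [eqS|neS] := pselect ([ffun i => a (lift ord0 i)] =
                               [ffun i => b (lift ord0 i)]); first by left.
    by right; split=> // i; rewrite !ffunE; exact: abG.
split=> [eqab|i]; first by apply: ab; rewrite eqab.
case: (unliftP ord0 i) => [j|] -> //.
case: abS => [/ffunP /(_ j)|[_ /(_ j)]]; rewrite !ffunE //; by left.
Qed.

Definition independent (V : Type) (G : graph V) (S : set V) : Prop :=
  forall u v, S u -> S v -> ~ G u v.

(* Extended-real valued: [counting S] is the number of elements of S, and +oo if
   S is infinite. *)
Definition alpha_grp (R : realType) (V : zmodType) (G : graph V) : \bar R :=
  ereal_sup [set counting S |
    S in [set S : set V | GRing.zmod_closed [in S] /\ independent G S]].

(* The vertex set of the n-th strong power is the group of functions
   {ffun 'I_n -> V} with pointwise addition. *)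
Definition Theta_grp (R : realType) (V : zmodType) (G : graph V) : \bar R :=
  ereal_sup [set (alpha_grp R (strong_pow G n) `^ n%:R^-1)%E |
    n in [set n : nat | (1 <= n)%N]].

(* The subgroup of integers of R: [Num.int_num_subdef] is the predicate
   underlying the qualifier [Num.int]. *)
Definition integers (R : realType) : zmodClosed R :=
  GRing.ZmodClosed.clone R (@Num.int_num_subdef R) _.

(* {ideal_quot I} is the quotient of an additive group by a subgroup I. *)
Definition circle (R : realType) : zmodType := {ideal_quot (integers R)}.

Definition circle_proj (R : realType) (t : R) : circle R :=
  \pi_{ideal_quot (integers R)} t.

Lemma circle_projP (R : realType) (s t : R) :
  reflect (circle_proj s = circle_proj t) (s - t \is a Num.int).
Proof.
apply: (iffP idP) => [st|/eqP]; last by rewrite /circle_proj -Quotient.idealrBE.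
by apply/eqP; rewrite /circle_proj -Quotient.idealrBE.
Qed.

(* Distance modulo 1: the infimum is a minimum, see [circle_dist_min]. *)
Definition circle_dist (R : realType) (u v : circle R) : R :=
  inf [set `|p.1 - p.2| | p in
    [set p : R * R | circle_proj p.1 = u /\ circle_proj p.2 = v]].

Lemma circle_dist_min (R : realType) (u v : circle R) :
  exists s t : R, [/\ circle_proj s = u, circle_proj t = v &
    circle_dist u v = `|s - t|].
Proof.
have [a <-] : exists a, circle_proj a = u by exists (repr u); exact: reprK.
have [b <-] : exists b, circle_proj b = v by exists (repr v); exact: reprK.
set D := [set p : R * R |
  circle_proj p.1 = circle_proj a /\ circle_proj p.2 = circle_proj b].
suff [p Dp pmin] : exists2 p, D p & forall q, D q -> `|p.1 - p.2| <= `|q.1 - q.2|.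
  exists p.1, p.2; have [-> ->] := Dp; split=> //.
  rewrite /circle_dist -/D; apply/eqP; rewrite eq_le; apply/andP; split.
    by apply: ge_inf; [exists 0 => _ [q _ <-] | exists p].
  by apply: lb_le_inf => [|_ [q Dq <-]]; [exists `|p.1 - p.2|, p | exact: pmin].
have fl1 := floor_le (a - b); have fl2 := floorD1_gt (a - b).
set k := Num.floor (a - b) in fl1 fl2; rewrite intrD in fl2.
have diff q : D q -> exists m : int, q.1 - q.2 = a - b - k%:~R + m%:~R.
  move=> [/circle_projP/intrP[m qm] /circle_projP/intrP[n qn]].
  by exists (m - n + k); rewrite !intrD mulrNz -qm -qn; lra.
have far (m : int) : a - b - k%:~R <= `|a - b - k%:~R + m%:~R| \/
    1 - (a - b - k%:~R) <= `|a - b - k%:~R + m%:~R|.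
  have [m0|m0] := leP 0 m; [left|right].
    have : (0 : R) <= m%:~R by rewrite ler0z.
    by move=> ?; apply: le_trans (ler_norm _); lra.
  have : m%:~R <= (-1 : R) by rewrite -(mulrN1z 1) ler_int -ltzD1 addNr.
  by move=> ?; rewrite -normrN; apply: le_trans (ler_norm _); lra.
have [h|h] := leP (a - b - k%:~R) (1 - (a - b - k%:~R)).
  exists (a - k%:~R, b).
    by split=> //=; apply/circle_projP/intrP; exists (- k); rewrite mulrNz; lra.
  move=> q /diff[m ->] /=.
  by rewrite ger0_norm; [have [] := far m; lra | lra].
exists (a - k%:~R - 1, b).
  split=> //=; apply/circle_projP/intrP; exists (- k - 1).
  by rewrite intrD !mulrNz; lra.
move=> q /diff[m ->] /=.
by rewrite ler0_norm; [have [] := far m; lra | lra].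
Qed.

Definition circle_graph (R : realType) (x : R) : graph (circle R) :=
  fun u v => u <> v /\ circle_dist u v < x^-1.

(* Main.v *)
Require Import Defs.
From mathcomp Require Import all_boot all_order all_algebra.
From mathcomp Require Import finmap generic_quotient ring_quotient.
From mathcomp Require Import all_classical all_reals all_analysis.
From mathcomp Require Import zify ring lra.
Import Order.TTheory GRing.Theory Num.Theory.
Import numFieldNormedType.Exports.
Local Open Scope classical_set_scope.
Local Open Scope ring_scope.

(** The limit follows from x - e <= Theta <= x, for every e > 0 and x large.

    The upper bound [Theta_grp_le] is the volume bound: an independent set of the
    n-th power is a packing of translates of a cube of side 1 / x in the torus, so
    it has at most x ^ n elements.

    For the lower bound, a subgroup of the torus of dimension n = p + 1 is given
    as the kernel of an integer matrix A. It has |det A| elements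
    ([card_torus_kernel]), and it is independent when no nonzero w with all
    |w_j| < 1 / x is mapped to an integer vector ([alpha_grp_kernel_ge]). Fix s
    and p, large in terms of e, and approximate x from below by a fraction
    X = S / s with S = s m + r and 0 <= r < s. One would like the dense matrix
    with diagonal m, entries X s^(j - i) below the diagonal and - r s^(j - i - 1)
    above it. Rounding its entries below the diagonal to integers and applying
    row operations leads to the sparse matrix [digit_mx]: one row of quotients
    lam_j = floor (m / s^(p - j)), and the relations S w_(j+1) - h_j w_j = 0 with
    the remainders h_j. Its determinant is at least X^p (X - 2)
    ([det_digit_mx_ge]), so its n-th root is X - O(1 / n).

    Independence ([digit_mx_short]) is a sign argument. A short vector w
    mapped to integers produces integers v_0, ..., v_p with
    s v_(j+1) - v_j = S w_(j+1) - h_j w_j, and shortness forces them into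
    {-1, 0, 1}. Row 0 of the dense matrix reads
    m w_0 = v_0 + r (sum_(j < p) s^j w_(j+1)), where the sum telescopes to about
    (s^p v_p - v_0) / S. If v_0 = 1, the signs h_j >= 0 prevent v_p = -1
    ([carry_chain_lead1]), so w_0 is at least 1 / x, a contradiction. By symmetry
    v_0 = 0; then w_0 is tiny, all v_j vanish and w = 0
    ([carry_chain_short_eq0]). The errors made by rounding are of lower order in
    m, and are absorbed by the slack S + 1 <= s x. *)

Set Implicit Arguments.
Unset Strict Implicit.
Unset Printing Implicit Defensive.

(** * The circle group and finite counting *)

Lemma circle_projB (R : realType) : {morph @circle_proj R : s t / s - t}.
Proof. exact: (raddfB (\pi_{ideal_quot (integers R)}%qT)). Qed.

Lemma circle_proj_eq0 (R : realType) (t : R) :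
  circle_proj t = 0 <-> t \is a Num.int.
Proof.
have p0 : circle_proj 0 = 0 :> circle R.
  exact: (raddf0 (\pi_{ideal_quot (integers R)}%qT)).
by rewrite -[t in t \is a _]subr0 -p0; split=> /circle_projP.
Qed.

Lemma circle_proj_lin (R : realType) (n : nat) (w : 'I_n -> R)
    (a : 'I_n -> int) :
  \sum_j circle_proj (w j) *~ a j = circle_proj (\sum_j w j * (a j)%:~R).
Proof.
rewrite [RHS](raddf_sum (\pi_{ideal_quot (integers R)}%qT)).
apply: eq_bigr => j _.
by rewrite mulrzr; rewrite (raddfMz (\pi_{ideal_quot (integers R)}%qT)).
Qed.

Lemma circle_dist_le (R : realType) (s t : R) :
  circle_dist (circle_proj s) (circle_proj t) <= `|s - t|.
Proof.
by apply: ge_inf; [exists 0 => _ [q _ <-] | exists (s, t)].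
Qed.

(** Adjacency in the strong power only concerns coordinatewise differences: two
    adjacent or equal vertices differ by the class of a short real number. *)
Lemma circle_short_rep (R : realType) (x : R) (u v : circle R) :
  0 < x -> u = v \/ circle_graph x u v ->
  exists2 w : R, circle_proj w = u - v & `|w| < x^-1.
Proof.
move=> x0 [->|[_ d]].
  by exists 0; rewrite ?normr0 ?invr_gt0 // subrr; apply/circle_proj_eq0.
have [s [t [su tv dE]]] := circle_dist_min u v.
by exists (s - t); rewrite ?circle_projB ?su ?tv -?dE.
Qed.

Lemma counting_ge (R : realType) (V : choiceType) (S : set V) (T : finType)
    (f : T -> V) : injective f -> (forall k, S (f k)) ->
  ((#|T|%:R : R)%:E <= counting S)%E.
Proof.
move=> finj fS; rewrite /counting; case: asboolP => [Sfin|_]; last exact: leey.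
rewrite lee_fin ler_nat cardE -(size_map f); apply: uniq_leq_size.
  by rewrite map_inj_uniq ?enum_uniq.
by move=> _ /mapP[k _ ->]; rewrite in_fset_set // inE.
Qed.

(** A bound for finite families is also what excludes infinite sets, on which
    [counting] is +oo. *)
Lemma counting_le (R : realType) (V : choiceType) (S : set V) (B : R) :
  (forall (T : finType) (f : T -> V),
    injective f -> (forall k, S (f k)) -> #|T|%:R <= B) ->
  (counting S <= B%:E)%E.
Proof.
move=> SB.
have bound (e : {fset V}) : [set` e] `<=` S -> (size (enum_fset e))%:R <= B.
  move=> eS; rewrite -[size _]card_ord.
  apply: (SB _ (tnth (in_tuple (enum_fset e)))) => [|k].
    by apply/tuple_uniqP; rewrite fset_uniq.
  by apply: eS; have := mem_tnth k (in_tuple (enum_fset e)).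
rewrite /counting; case: asboolP => [Sfin|Sinf].
  by rewrite lee_fin; apply: bound; rewrite fset_setK.
have [e eS ne] := infinite_set_fset (Num.truncn B).+1 Sinf.
have := bound e eS; rewrite leNgt => /negP[]; apply: lt_le_trans (truncnS_gt B) _.
by rewrite ler_nat.
Qed.

(** * Upper bound by cube packing *)

(** The volume bound for packing cubes of side 1 / x in the torus, with volume
    replaced by counting cells of a grid of mesh 1 / M. Translating the cell of
    each point by [0, K)^n, where K <= M / x, gives pairwise disjoint blocks of
    K ^ n cells: a common cell would put two points at distance less than
    K / M <= 1 / x in every coordinate. *)
Lemma packing_bound (R : realType) (n M K : nat) (x : R) (T : finType)
    (f : T -> {ffun 'I_n -> circle R}) :
  1 <= x -> (0 < M)%N -> K%:R * x <= M%:R -> injective f ->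
  (forall k l, ~ strong_pow (circle_graph x) n (f k) (f l)) ->
  (#|T| * K ^ n <= M ^ n)%N.
Proof.
move=> x1 M0 KM finj find.
have x0 : 0 < x by lra.
have MR : 0 < M%:R :> R by rewrite ltr0n.
pose t k i : R := repr (f k i).
have tE k i : circle_proj (t k i) = f k i by exact: reprK.
(* a k i numbers the cell of side 1 / M that contains the i-th coordinate. *)
pose a k i : int := Num.floor (M%:R * t k i).
have modM (z : int) : (`|(z %% M%:Z)%Z|%N < M)%N.
  by have := modz_ge0 z (_ : M%:Z != 0); have := ltz_pmod z (_ : 0 < M%:Z); lia.
pose g (ke : T * {ffun 'I_n -> 'I_K}) : {ffun 'I_n -> 'I_M} :=
  [ffun i => Ordinal (modM (a ke.1 i + (ke.2 i : nat)%:Z))].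
have gE k l e d : g (k, e) = g (l, d) ->
    forall i, exists z : int, a k i - a l i = (d i : nat)%:Z - (e i : nat)%:Z + z * M.
  move=> /ffunP ge i; have /(congr1 val) := ge i; rewrite !ffunE /= => gi.
  exists (((a k i + (e i : nat)%:Z) %/ M%:Z)%Z - ((a l i + (d i : nat)%:Z) %/ M%:Z)%Z).
  have := divz_eq (a k i + (e i : nat)%:Z) M%:Z.
  have := divz_eq (a l i + (d i : nat)%:Z) M%:Z.
  have := modz_ge0 (a k i + (e i : nat)%:Z) (_ : M%:Z != 0).
  have := modz_ge0 (a l i + (d i : nat)%:Z) (_ : M%:Z != 0).
  by lia.
have ginj : injective g.
  move=> [k e] [l d] /gE gi.
  have kl : k = l.
    apply: finj; apply: contrapT => fkl; apply: (find k l); split=> // i.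
    have [|fi] := pselect (f k i = f l i); [by left|right; split=> //].
    have [z zE] := gi i.
    have lproj : circle_proj (t l i + z%:~R) = f l i.
      rewrite -tE; apply/circle_projP.
      by rewrite addrC addKr; exact: intr_int.
    rewrite -lproj -(tE k i); apply: le_lt_trans (circle_dist_le _ _) _.
    have ak := floor_itv (M%:R * t k i); have al := floor_itv (M%:R * t l i).
    rewrite -/(a k i) -/(a l i) !intrD in ak al.
    move: ak al => /andP[ak1 ak2] /andP[al1 al2].
    have {}zE : (a k i)%:~R - (a l i)%:~R = (d i)%:R - (e i)%:R + z%:~R * M%:R :> R.
      by have := congr1 (fun y : int => y%:~R : R) zE; rewrite !rmorphD !rmorphN rmorphM.
    have [ei di] : (e i)%:R + 1 <= K%:R :> R /\ (d i)%:R + 1 <= K%:R :> R.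
      by rewrite !natr1 !ler_nat !ltn_ord.
    have e0 : 0 <= (e i)%:R :> R by []. have d0 : 0 <= (d i)%:R :> R by [].
    (* d - e is an integer of size at most K - 1, and rounding down moves
       the difference by strictly less than 1. *)
    have : M%:R * `|t k i - (t l i + z%:~R)| < K%:R.
      rewrite -{1}(gtr0_norm MR) -normrM ltr_norml; apply/andP; split; nra.
    move: `|_| => y yK; rewrite -[x^-1]mul1r ltr_pdivlMr // -(ltr_pM2l MR).
    by rewrite mulr1 mulrA; apply: lt_le_trans KM; rewrite ltr_pM2r.
  rewrite -{l}kl in gi *; congr (_, _); apply/ffunP => i; apply/val_inj => /=.
  have [z] := gi i; rewrite subrr.
  have KMn : (K <= M)%N by rewrite -(ler_nat R); apply: le_trans KM; rewrite ler_peMr.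
  move: (ltn_ord (e i)) (ltn_ord (d i)) => eK dK zM.
  have [z1|[z1|z0]] : z <= -1 \/ 1 <= z \/ z = 0 by lia.
  - by have : z * M%:Z <= -1 * M%:Z; [rewrite ler_wpM2r | lia].
  - by have : 1 * M%:Z <= z * M%:Z; [rewrite ler_wpM2r | lia].
  - by rewrite z0 in zM; lia.
have := leq_card g ginj.
by rewrite card_prod !card_ffun !card_ord.
Qed.

Lemma alpha_grp_ge0 (R : realType) (n : nat) (x : R) :
  (0 <= alpha_grp R (strong_pow (circle_graph x) n))%E.
Proof.
apply: (@le_trans _ _ (counting [set (0 : {ffun 'I_n -> circle R})])).
  by rewrite /counting; case: asboolP => // _; rewrite lee_fin.
apply: ereal_sup_ubound; exists [set 0] => //; split.
  by split=> [|u v]; rewrite !inE // => -> ->; rewrite subr0.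
by move=> u v -> -> [].
Qed.

(** Refining the grid makes M / K tend to x; the margin d replaces the limit. *)
Lemma alpha_grp_le (R : realType) (n : nat) (x d : R) : 1 <= x -> 0 < d ->
  (alpha_grp R (strong_pow (circle_graph x) n) <= ((x + d) ^+ n)%:E)%E.
Proof.
move=> x1 d0; apply: ge_ereal_sup => _ [S [_ Sind] <-].
apply: counting_le => T f finj fS.
have x0 : 0 < x by lra.
(* M / floor (M / x) is at most x M / (M - x), hence at most x + d as soon as
   M d exceeds x (x + d). *)
set M := (Num.truncn (x * (x + d) / d)).+1.
have MR : x * (x + d) < M%:R * d.
  by rewrite -ltr_pdivrMr // /M; exact: truncnS_gt.
set K := Num.truncn (M%:R / x).
have K1 : M%:R / x < K%:R + 1 by rewrite natr1; exact: truncnS_gt.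
have K2 : K%:R <= M%:R / x by rewrite truncn_le divr_ge0 // ltW.
rewrite ltr_pdivrMr // in K1; rewrite ler_pdivlMr // in K2.
have M0 : 0 < M%:R :> R by rewrite ltr0n.
have MK : M%:R <= K%:R * (x + d).
  have : M%:R * (x + d) < (K%:R + 1) * x * (x + d) by rewrite ltr_pM2r //; lra.
  by move=> ?; rewrite -(ler_pM2r x0); nra.
have K0 : 0 < K%:R :> R.
  by rewrite lt_neqAle ler0n andbT; apply/eqP => k0; rewrite -k0 mul0r in MK; lra.
have := packing_bound x1 (ltn0Sn _ : (0 < M)%N) K2 finj
  (fun k l => Sind _ _ (fS k) (fS l)).
rewrite -(ler_nat R) natrM !natrX => TM.
rewrite -(ler_pM2r (exprn_gt0 n K0)); apply: le_trans TM _.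
by rewrite mulrC -exprMn; apply: lerXn2r; rewrite ?nnegrE ?mulr_ge0 //; lra.
Qed.

Lemma Theta_grp_le (R : realType) (x : R) : 1 <= x ->
  (Theta_grp R (circle_graph x) <= x%:E)%E.
Proof.
move=> x1; apply/lee_addgt0Pr => d d0; rewrite -EFinD.
apply: ge_ereal_sup => _ [n /= n1 <-].
have nR : n%:R != 0 :> R by rewrite pnatr_eq0 -lt0n.
have xd : 0 <= x + d by lra.
have -> : (x + d)%:E = (((x + d) ^+ n)%:E `^ n%:R^-1)%E :> \bar R.
  by rewrite poweR_EFin -powR_mulrn // -powRrM mulfV // powRr1.
apply: gt0_ler_poweR; rewrite ?invr_ge0 //; last exact: alpha_grp_le.
  by rewrite in_itv /= alpha_grp_ge0 leey.
by rewrite in_itv /= lee_fin exprn_ge0 // leey.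
Qed.

(** * Kernels of integer matrices on the torus *)

(** An integer matrix A acts on the torus as a group endomorphism whose kernel has
    |det A| elements when det A is nonzero: Smith normal form reduces this to
    diagonal matrices, for which the kernel is a product of cyclic groups of
    orders |d_i|. *)
Lemma card_torus_kernel (R : realType) (n : nat) (A : 'M[int]_n) :
  \det A != 0 ->
  exists (T : finType) (f : T -> {ffun 'I_n -> circle R}),
    [/\ #|T| = `|\det A|%N, injective f &
        forall k i, \sum_j f k j *~ A i j = 0].
Proof.
have [L Lu [U Uu [d _ ->]]] := int_Smith_normal_form A.
set D := \matrix_(i, j) _.
have absu (V : 'M[int]_n) : V \in unitmx -> `|\det V|%N = 1%N.
  by rewrite unitmxE; move: (\det V) => q; case/orP => /eqP ->.
pose e (i : 'I_n) : int := d`_i.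
have DE : D = diag_mx (\row_i e i) by apply/matrixP=> i j; rewrite !mxE.
have absD : `|\det (L *m D *m U)|%N = (\prod_(i < n) `|e i|)%N.
  rewrite !det_mulmx !abszM (absu _ Lu) (absu _ Uu) mul1n muln1 DE det_diag.
  under eq_bigr do rewrite mxE.
  by elim/big_rec2: _ => // i a b _ <-; rewrite abszM.
rewrite -absz_gt0 absD => d_gt0.
have dn0 (i : 'I_n) : (0 < `|e i|)%N.
  by move: d_gt0; rewrite (bigD1 i) //= muln_gt0 => /andP[].
have dR (i : 'I_n) : (e i)%:~R != 0 :> R by rewrite intr_eq0 -absz_gt0.
(* With A = L D U, the solutions are w = U^-1 (k_i / d_i)_i, as A w = L k. *)
pose I (k m : nat) (M : 'M[int]_(k, m)) : 'M[R]_(k, m) := map_mx intr M.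
pose c (k : fprod (fun i : 'I_n => 'I_(`|e i|))) : 'cV[R]_n :=
  \col_i ((k i : nat)%:R / (e i)%:~R).
pose w k := I _ _ (invmx U) *m c k.
exists (fprod (fun i : 'I_n => 'I_(`|e i|)) : finType).
exists (fun k => [ffun i => circle_proj (w k i 0)]).
split.
- by rewrite card_fprod; apply: eq_bigr => i _; rewrite card_ord.
- move=> k k' /ffunP ekk'.
  have [z zE] : exists z : 'cV[int]_n, w k - w k' = I _ _ z.
    exists (\col_i Num.floor ((w k - w k') i 0)).
    apply/matrixP => i j; rewrite ord1 [RHS]mxE [X in X%:~R]mxE.
    apply/esym/eqP; rewrite -intrEfloor !mxE.
    by apply/circle_projP; have := ekk' i; rewrite !ffunE !mxE.
  have cE : c k - c k' = I _ _ (U *m z).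
    rewrite /I map_mxM -/(I _ _ z) -zE -mulmxBr mulmxA -map_mxM mulmxV //.
    by rewrite map_mx1 mul1mx.
  apply/fprodP => i; apply/val_inj/eqP; rewrite /= -(eqr_nat R) -subr_eq0.
  have /matrixP/(_ i 0) := cE; rewrite !mxE -mulrBl => /eqP.
  move: (\sum_j _) => q; rewrite -(inj_eq (mulIf (dR i))) divfK // => /eqP ke.
  have : `|((k i : nat)%:R - (k' i : nat)%:R : R)| < (`|e i|%N)%:R.
    rewrite ltr_norml; have := ltn_ord (k i); have := ltn_ord (k' i).
    rewrite -(ltr_nat R) => a1; rewrite -(ltr_nat R) => a2.
    have : 0 <= (k i)%:R :> R by []. have : 0 <= (k' i)%:R :> R by [].
    by move=> *; apply/andP; split; lra.
  rewrite ke normrM -!intr_norm natr_absz gtr_pMl ?normr_gt0 //; last first.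
    by rewrite ltr0z normr_gt0 -absz_gt0.
  by rewrite ltrz1 => q0; rewrite (_ : q = 0) ?mulr0z ?mul0r ?eqxx //; lia.
- move=> k i; under eq_bigr do rewrite ffunE.
  rewrite circle_proj_lin; apply/circle_proj_eq0.
  pose kz : 'cV[int]_n := \col_i (k i : nat)%:Z.
  suff -> : \sum_j w k j 0 * ((L *m D *m U) i j)%:~R = ((L *m kz) i 0)%:~R.
    exact: intr_int.
  have : I _ _ (L *m D *m U) *m w k = I _ _ (L *m kz).
    rewrite /I /w mulmxA -map_mxM -mulmxA mulmxV // mulmx1 map_mxM -mulmxA.
    rewrite map_mxM; congr (_ *m _); apply/matrixP => a b.
    rewrite ord1 DE map_diag_mx mul_diag_mx !mxE.
    by rewrite mulrC divfK.
  move=> /matrixP/(_ i 0); rewrite !mxE => <-.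
  by apply: eq_bigr => j _; rewrite mulrC !mxE.
Qed.

(** Differences of adjacent kernel elements are kernel elements that lift to short
    vectors, so the kernel is independent when A maps no short nonzero vector to
    an integer vector. *)
Lemma alpha_grp_kernel_ge (R : realType) (n : nat) (x : R) (A : 'M[int]_n) :
  0 < x -> \det A != 0 ->
  (forall w : 'I_n -> R, (forall j, `|w j| < x^-1) ->
    (forall i, \sum_j w j * (A i j)%:~R \is a Num.int) ->
    forall j, w j = 0) ->
  ((`|\det A|%N%:R : R)%:E <= alpha_grp R (strong_pow (circle_graph x) n))%E.
Proof.
move=> x0 dA short.
have [T [f [cT finj fA]]] := card_torus_kernel R dA.
pose K : set {ffun 'I_n -> circle R} :=
  [set u | forall i, \sum_j u j *~ A i j = 0].
rewrite -cT; apply: le_trans (counting_ge R (S := K) finj fA) _.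
have KB u v : K u -> K v -> K (u - v).
  move=> Ku Kv i; under eq_bigr do rewrite !ffunE mulrzBl.
  by rewrite big_split /= sumrN Ku Kv subrr.
apply: ereal_sup_ubound; exists K => //; split.
  split; first by rewrite inE => i; apply: big1 => j _; rewrite ffunE mul0rz.
  by move=> u v; rewrite !inE; exact: KB.
move=> u v Ku Kv [uv adj]; apply: uv; apply/eqP; rewrite -subr_eq0; apply/eqP.
have /choice[w wP] j : exists w : R, circle_proj w = u j - v j /\ `|w| < x^-1.
  by have [w] := circle_short_rep x0 (adj j); exists w.
have w0 := short w (fun j => (wP j).2).
apply/ffunP => j; rewrite !ffunE -(wP j).1 w0; first exact/circle_proj_eq0.
move=> i; apply/circle_proj_eq0; rewrite -circle_proj_lin.
by rewrite -[RHS](KB _ _ Ku Kv i); apply: eq_bigr => k _; rewrite (wP k).1 !ffunE.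
Qed.

(** * Carry chains *)

(** The relations S w_(j+1) - h_j w_j = s v_(j+1) - v_j for 0 <= j < p, with integers
    v_j, rescaled by y = x w so that short vectors are those with |y_j| < 1. They
    resemble the carry rule of a base s expansion; the v_j are called digits. *)
Definition carry_chain (R : realType) (p : nat) (s S x : R) (h y v : nat -> R) : Prop :=
  forall j, (j < p)%N ->
    S * y j.+1 = x * (s * v j.+1 - v j) + h j * y j.

Lemma carry_chainN (R : realType) (p : nat) (s S x : R) (h y v : nat -> R) :
  carry_chain p s S x h y v ->
  carry_chain p s S x h (fun j => - y j) (fun j => - v j).
Proof. by move=> vy j /vy e; rewrite mulrN e; ring. Qed.

Lemma int_abs_lt2 (R : realType) (k : R) :
  k \is a Num.int -> `|k| < 2 -> [\/ k = 0, k = 1 | k = -1].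
Proof.
move=> /intrP[z ->]; rewrite -intr_norm (_ : 2 = 2%:~R) // ltr_int => z2.
have [->|[->|->]] : z = 0 \/ z = 1 \/ z = -1 by lia.
- exact: Or31.
- exact: Or32.
- by apply: Or33; rewrite mulrN1z.
Qed.

(** Since S <= s x, one step of the chain gives s |v_(j+1)| < |v_j| + s + 1, so the
    bound |v_j| <= 1 propagates because s >= 2. *)
Lemma carry_chain_digits (R : realType) (p : nat) (s S x H : R)
    (h y : nat -> R) (v : nat -> R) :
  2 <= s -> S <= s * x -> H <= x ->
  (forall j, (j < p)%N -> 0 <= h j <= H) ->
  (forall j, (j <= p)%N -> `|y j| < 1) -> 0 < S ->
  carry_chain p s S x h y v ->
  (forall j, (j <= p)%N -> v j \is a Num.int) -> `|v 0| < (2 : R) ->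
  forall j, (j <= p)%N -> [\/ v j = 0, v j = 1 | v j = -1].
Proof.
move=> s2 Ssx Hx hH y1 S0 vy vi v0.
elim=> [|j IH] jp; first exact: int_abs_lt2 (vi _ jp) v0.
apply: int_abs_lt2; first exact: vi.
have e := vy _ jp; have /andP[h0 h1] := hH _ jp.
have := y1 _ jp; have := y1 _ (ltnW jp).
rewrite !ltr_norml => /andP[a1 a2] /andP[b1 b2].
have x0 : 0 < x by nra.
have vj : -1 <= v j <= (1 : R).
  by case: (IH (ltnW jp)) => ->; apply/andP; split; lra.
move: vj => /andP[c1 c2].
set w := v j.+1 in e *; set w' := v j in e c1 c2.
have hy : - x <= h j * y j <= x by apply/andP; split; nra.
move: hy => /andP[d1 d2].
have Sy : - (s * x) < S * y j.+1 < s * x by apply/andP; split; nra.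
move: Sy => /andP[f1 f2].
have xw : - x <= x * w' <= x by apply/andP; split; nra.
move: xw => /andP[g1 g2].
have sx : 0 < s * x by nra.
have k : - (2 * (s * x)) < (s * x) * w < 2 * (s * x) by apply/andP; split; nra.
move: k => /andP[k1 k2].
by apply/andP; split; nra.
Qed.

(** A chain starting with the digit 1 never reaches -1. A direct step from 1 to -1
    would make |y_(j+1)| too large; after a step from 1 to 0 the coordinate is
    negative, the feedback h_j y_j with h_j >= 0 keeps it nonpositive as long as
    the digit stays 0, and then moving to -1 would push it to -1 or below. *)
Lemma carry_chain_lead1 (R : realType) (p : nat) (s S x H : R)
    (h y : nat -> R) (v : nat -> R) :
  2 <= s -> S <= s * x -> H < x ->
  (forall j, (j < p)%N -> 0 <= h j <= H) ->
  (forall j, (j <= p)%N -> `|y j| < 1) -> 0 < S ->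
  carry_chain p s S x h y v ->
  (forall j, (j <= p)%N -> v j \is a Num.int) -> v 0 = 1 ->
  forall j, (j <= p)%N -> v j = 1 \/ (v j = 0 /\ y j <= 0).
Proof.
move=> s2 Ssx Hx hH y1 S0 vy vi v0.
have dig : forall j, (j <= p)%N -> [\/ v j = 0, v j = 1 | v j = -1].
  apply: (carry_chain_digits (H := H)) vy vi _ => //; first exact: ltW.
  by rewrite v0 normr1; lra.
elim=> [|j IH] jp; first by left.
have e := vy _ jp; have /andP[h0 h1] := hH _ jp.
have := y1 _ jp; have := y1 _ (ltnW jp).
rewrite !ltr_norml => /andP[a1 a2] /andP[b1 b2].
have x0 : 0 < x by nra.
have hy : h j * y j < x by nra.
(* The digit -1 would need S y_(j+1) = - x s - x v_j + h_j y_j, which is at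
   most - S whether v_j = 1 or v_j = 0 and y_j <= 0. *)
case: (dig _ jp) => vj; [right|by left|exfalso]; rewrite vj in e.
  split=> //; case: (IH (ltnW jp)) => [vj0|[vj0 yj0]]; rewrite vj0 in e; nra.
have Sy : - (s * x) < S * y j.+1 by nra.
case: (IH (ltnW jp)) => [vj0|[vj0 yj0]]; rewrite vj0 in e; nra.
Qed.

(** Weighting the j-th relation by s ^ j makes the digits telescope. *)
Lemma carry_chain_sum (R : realType) (p : nat) (s S x : R)
    (h y v : nat -> R) :
  carry_chain p s S x h y v ->
  S * (\sum_(j < p) s ^+ j * y j.+1) =
  x * (s ^+ p * v p - v 0) + \sum_(j < p) s ^+ j * (h j * y j).
Proof.
elim: p => [|p IH] vy; first by rewrite !big_ord0 expr0; ring.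
rewrite !big_ord_recr /= mulrDr IH; last by move=> j jp; apply: vy; exact: ltnW.
by rewrite mulrCA (vy p (ltnSn p)) exprS; ring.
Qed.

(** If the first digit is 0 and y_0 is so small that H |y_0| <= 1, a nonzero next
    digit would force S |y_(j+1)| >= s x - 1 >= S; hence all digits vanish and the
    coordinates do not grow. *)
Lemma carry_chain_lead0 (R : realType) (p : nat) (s S x H : R)
    (h y : nat -> R) (v : nat -> R) :
  2 <= s -> S + 1 <= s * x -> H < x -> H <= S -> H * `|y 0| <= 1 ->
  (forall j, (j < p)%N -> 0 <= h j <= H) ->
  (forall j, (j <= p)%N -> `|y j| < 1) -> 0 < S ->
  carry_chain p s S x h y v ->
  (forall j, (j <= p)%N -> v j \is a Num.int) -> v 0 = 0 ->
  forall j, (j <= p)%N -> v j = 0 /\ `|y j| <= `|y 0|.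
Proof.
move=> s2 Ssx Hx HS Hy hH y1 S0 vy vi v0.
have dig : forall j, (j <= p)%N -> [\/ v j = 0, v j = 1 | v j = -1].
  by apply: (carry_chain_digits (H := H)) vy vi _ => //;
    [lra | exact: ltW | rewrite v0 normr0; lra].
elim=> [|j IH] jp //.
have [vj0 yj] := IH (ltnW jp).
have e := vy _ jp; have /andP[h0 h1] := hH _ jp.
rewrite vj0 subr0 in e.
have hy : `|h j * y j| <= H * `|y 0|.
  by rewrite normrM (ger0_norm h0); apply: ler_pM.
have hy1 : `|h j * y j| <= 1 by exact: le_trans Hy.
have Hy0 : H * `|y 0| <= S * `|y 0| by rewrite ler_wpM2r.
have := y1 _ jp.
rewrite ltr_norml => /andP[b1 b2].
move: hy1; rewrite ler_norml => /andP[c1 c2].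
case: (dig _ jp) => vj; rewrite vj in e.
- split=> //; rewrite mulr0 mulr0 add0r in e.
  rewrite -(ler_pM2l S0) -{1}(gtr0_norm S0) -normrM e.
  exact: le_trans Hy0.
- by exfalso; nra.
- by exfalso; nra.
Qed.

Lemma geo_weighted_le (R : realType) (p : nat) (s B : R) (z : nat -> R) :
  1 <= s -> (forall j, (j < p)%N -> `|z j| <= B) ->
  `|\sum_(j < p) s ^+ j * z j| <= p%:R * (s ^+ p * B).
Proof.
move=> s1 zB; apply: le_trans (ler_norm_sum _ _ _) _.
rewrite -[p in p%:R]card_ord mulr_natl -sumr_const.
apply: ler_sum => j _; have s0 : 0 <= s by lra.
rewrite normrM ger0_norm ?exprn_ge0 //.
apply: ler_pM; rewrite ?exprn_ge0 //; last exact: zB.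
by rewrite ler_weXn2l // ltnW.
Qed.

(** The equation for m y_0 is the row of index 0 of the dense matrix. If v_0 = 1
    then the last digit is nonnegative, so by telescoping the weighted sum of the
    coordinates is at least about - x / S, and the row gives
    m y_0 >= x - r x / S - error >= m, using S = s m + r and S + 1 <= s x: after
    multiplication by S, the margin S (x - m) - r x is at least m, while the
    error is independent of m. *)
Lemma carry_chain_no_lead1 (R : realType) (p : nat) (s m r x : R)
    (h y v : nat -> R) :
  let S := s * m + r in
  2 <= s -> 0 <= r <= s - 1 -> s * (p.+1%:R * (s ^+ p) ^+ 2) <= m ->
  S + 1 <= s * x ->
  (forall j, (j < p)%N -> 0 <= h j <= s ^+ p) ->
  carry_chain p s S x h y v ->
  (forall j, (j <= p)%N -> v j \is a Num.int) ->
  (forall j, (j <= p)%N -> `|y j| < 1) ->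
  m * y 0 = x * v 0 + r * \sum_(j < p) s ^+ j * y j.+1 ->
  v 0 <> 1.
Proof.
move=> S s2 /andP[r0 r1] Cm Ssx hH vy vi y1 row0 v01.
have G1 : 1 <= s ^+ p by rewrite exprn_ege1 //; lra.
have E := carry_chain_sum vy.
have err : `|\sum_(j < p) s ^+ j * (h j * y j)| <= p%:R * (s ^+ p * s ^+ p).
  apply: (@geo_weighted_le R p s (s ^+ p) (fun j => h j * y j)); first lra.
  move=> j jp; have /andP[h0 h1] := hH _ jp.
  rewrite normrM (ger0_norm h0) -[leRHS]mulr1.
  by apply: ler_pM => //; exact/ltW/y1/ltnW.
move: (\sum_(j < p) _ * (h j * _)) err E => e1 err E.
move: (\sum_(j < p) _) E row0 => Y E row0.
set G := s ^+ p in Cm hH G1 err E.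
have P0 : 0 <= p%:R :> R by [].
have pG : 0 <= p%:R * (G * G) :> R by rewrite !mulr_ge0 //; lra.
have GG : 1 <= G * G by nra.
have Cm' : s * (p%:R * (G * G)) + s * (G * G) <= m.
  by apply: le_trans Cm; rewrite le_eqVlt -natr1; apply/orP; left; apply/eqP; ring.
move: (p%:R * (G * G)) pG err Cm' => q q0 err Cm'.
have m0 : 0 < m by nra.
have GGs : G <= s * (G * G) by nra.
have S0 : 0 < S by rewrite /S; nra.
have mx : m <= x by rewrite /S in Ssx; nra.
have vp : 0 <= v p.
  have := carry_chain_lead1 s2 _ _ hH y1 S0 vy vi v01 (leqnn p).
  case; first by lra.
  - by rewrite -/G; nra.
  - by move=> ->.
  - by case=> ->.
move: err; rewrite ler_norml => /andP[e1q _].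
have SY : - x - q <= S * Y.
  have xG : 0 <= x * (G * v p) by rewrite !mulr_ge0 //; lra.
  by rewrite E v01; nra.
have := y1 0%N (leq0n _); rewrite ltr_norml => /andP[_ y01].
rewrite v01 mulr1 in row0.
have mxY : m > x + r * Y by nra.
have Smx : S * (x - m) < r * (x + q).
  have : S * (x + r * Y) < S * m by rewrite ltr_pM2l.
  have : r * (- x - q) <= r * (S * Y) by rewrite ler_wpM2l.
  nra.
(* This is where the slack in S + 1 <= s x pays: without it x - m could equal
   r / s and the error term r q would not be absorbed. *)
have d : r + 1 <= s * (x - m) by rewrite /S in Ssx; nra.
have : m * (r + 1) <= m * (s * (x - m)) by rewrite ler_wpM2l // ltW.
have : r * q <= m by nra.
rewrite /S in Smx; nra.
Qed.

(** By the previous lemma applied to y and to - y the first digit is 0. The row of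
    index 0 then makes y_0 of order 1 / m, all digits vanish, every coordinate is
    bounded by |y_0|, and the row bounds m |y_0| by a constant times |y_0|. *)
Lemma carry_chain_short_eq0 (R : realType) (p : nat) (s m r x : R)
    (h y v : nat -> R) :
  let S := s * m + r in
  2 <= s -> 0 <= r <= s - 1 -> s * (p.+1%:R * (s ^+ p) ^+ 2) <= m ->
  S + 1 <= s * x ->
  (forall j, (j < p)%N -> 0 <= h j <= s ^+ p) ->
  carry_chain p s S x h y v ->
  (forall j, (j <= p)%N -> v j \is a Num.int) ->
  (forall j, (j <= p)%N -> `|y j| < 1) ->
  m * y 0 = x * v 0 + r * \sum_(j < p) s ^+ j * y j.+1 ->
  forall j, (j <= p)%N -> y j = 0.
Proof.
move=> S s2 r01 Cm Ssx hH vy vi y1 row0.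
have v1 := carry_chain_no_lead1 s2 r01 Cm Ssx hH vy vi y1 row0.
have vN1 : - v 0 <> 1.
  apply: (carry_chain_no_lead1 s2 r01 Cm Ssx hH (carry_chainN vy)).
  - by move=> j jp; rewrite rpredN vi.
  - by move=> j jp; rewrite normrN y1.
  - rewrite mulrN row0; under [in RHS]eq_bigr do rewrite mulrN.
    by rewrite sumrN; ring.
move: r01 => /andP[r0 r1].
have G1 : 1 <= s ^+ p by rewrite exprn_ege1 //; lra.
have s1 : 1 <= s by lra.
have YB B : (forall j, (j <= p)%N -> `|y j| <= B) ->
    `|\sum_(j < p) s ^+ j * y j.+1| <= p%:R * (s ^+ p * B).
  by move=> yB; apply: (@geo_weighted_le R p s B (fun j => y j.+1)) => // j /yB.
move: (\sum_(j < p) _) YB row0 => Y YB row0.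
have Y1 := YB 1 (fun j jp => ltW (y1 j jp)); rewrite mulr1 in Y1.
set G := s ^+ p in Cm hH G1 YB Y1.
have P0 : 0 <= p%:R :> R by [].
have PG : 0 <= p%:R * G by rewrite mulr_ge0 //; lra.
have PGG : p%:R * G <= p%:R * (G * G) by rewrite ler_wpM2l //; nra.
have Cm' : s * (p%:R * (G * G)) + s * (G * G) <= m.
  by apply: le_trans Cm; rewrite le_eqVlt -natr1; apply/orP; left; apply/eqP; ring.
have GG : 1 <= G * G by nra.
have GGs : G <= s * (G * G) by nra.
have m0 : 0 < m by nra.
have S0 : 0 < S by rewrite /S; nra.
have mx : m < x by rewrite /S in Ssx; nra.
have rPG : r * (p%:R * G) < m by nra.
have rY : `|r * Y| <= r * (p%:R * G) by rewrite normrM (ger0_norm r0) ler_wpM2l.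
have v0 : v 0 = 0.
  have : `|v 0| < 2.
    have : x * `|v 0| < x * 2.
      rewrite -{1}(gtr0_norm (lt_trans m0 mx)) -normrM.
      have -> : x * v 0 = m * y 0 - r * Y by rewrite row0; ring.
      have my : `|m * y 0| <= m.
        by rewrite normrM (gtr0_norm m0) -[leRHS]mulr1 ler_wpM2l ?ltW ?y1.
      have := ler_normB (m * y 0) (r * Y); lra.
    by rewrite ltr_pM2l // (lt_trans m0 mx).
  case/(int_abs_lt2 (vi 0%N (leq0n _))) => // v0.
  by case: vN1; rewrite v0 opprK.
rewrite v0 mulr0 add0r in row0.
have Gy0 : G * `|y 0| <= 1.
  have my : m * `|y 0| <= r * (p%:R * G).
    by rewrite -{1}(gtr0_norm m0) -normrM row0.
  have : m * (G * `|y 0|) <= m * 1.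
    have : G * (m * `|y 0|) <= G * (r * (p%:R * G)) by rewrite ler_wpM2l //; lra.
    have : r * (p%:R * (G * G)) <= s * (p%:R * (G * G)).
      by rewrite ler_wpM2r ?mulr_ge0 //; lra.
    nra.
  by rewrite ler_pM2l.
have GS : G <= S by rewrite /S; nra.
have Gx : G < x by nra.
have all0 := carry_chain_lead0 s2 Ssx Gx GS Gy0 hH y1 S0 vy vi v0.
have y00 : `|y 0| = 0.
  have Y0 := YB _ (fun j jp => (all0 j jp).2).
  have : m * `|y 0| <= r * (p%:R * (G * `|y 0|)).
    rewrite -{1}(gtr0_norm m0) -normrM row0 normrM (ger0_norm r0).
    by rewrite ler_wpM2l.
  have := normr_ge0 (y 0); move: `|y 0| => t t0 tt.
  by apply/eqP; rewrite eq_le t0 andbT; nra.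
by move=> j jp; have [_] := all0 j jp; rewrite y00 normr_le0 => /eqP.
Qed.

(** * A chain matrix with large determinant *)

(** The rows below the first are the left-hand sides of the relations of a carry
    chain; row 0 provides one more integer, from which the digits are computed. *)
Definition chain_mx (p : nat) (S : int) (lam h : nat -> int) : 'M[int]_p.+1 :=
  \matrix_(i, j) if i == ord0 then lam j
                 else if j == i then S
                 else if j.+1 == i then - h j else 0.

(** Expansion along column 0, whose nonzero entries are in rows 0 and 1. The first
    minor is triangular; the second is again a chain matrix. *)
Lemma det_chain_mxS (p : nat) (S : int) (lam h : nat -> int) :
  \det (chain_mx p.+1 S lam h) =
  lam 0 * S ^+ p.+1 +
  h 0 * \det (chain_mx p S (fun j => lam j.+1) (fun j => h j.+1)).
Proof.
rewrite (expand_det_col _ ord0) big_ord_recl big_ord_recl.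
rewrite [X in _ + (_ + X)]big1 ?addr0; last first.
  by move=> i _; rewrite !mxE /= mul0r.
congr (_ + _).
  rewrite mxE /= /cofactor /= addn0 expr0 mul1r; congr (_ * _).
  rewrite det_trig; last first.
    apply/is_trig_mxP => i j ij; rewrite !mxE /= /bump /= !add1n.
    rewrite -val_eqE /= /bump /= !add1n eqSS (gtn_eqF ij) ifN //.
    by rewrite eqSS; lia.
  rewrite -[in RHS](card_ord p.+1) -prodr_const; apply: eq_bigr => i _.
  by rewrite !mxE /= eqxx.
rewrite !mxE /= /cofactor /= addn0 expr1 mulN1r mulrNN; congr (_ * \det _).
apply/matrixP => i j; rewrite !mxE.
case: (unliftP ord0 i) => [k|] ->; last first.
  by rewrite /= ?/bump /= ?add1n.
rewrite -!val_eqE /= /bump /= !add1n.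
by rewrite !eqSS.
Qed.

Lemma det_chain_mx_ge0 (p : nat) (S : int) (lam h : nat -> int) :
  0 <= S -> (forall j, 0 <= lam j) -> (forall j, 0 <= h j) ->
  0 <= \det (chain_mx p S lam h).
Proof.
elim: p lam h => [|p IH] lam h S0 lam0 h0; first by rewrite det_mx11 mxE /=.
by rewrite det_chain_mxS addr_ge0 ?mulr_ge0 ?exprn_ge0 ?IH.
Qed.

(** The expansion of the determinant has only nonnegative terms, and its first two
    already give its leading order. *)
Lemma det_chain_mx_ge (p : nat) (S : int) (lam h : nat -> int) :
  0 <= S -> (forall j, 0 <= lam j) -> (forall j, 0 <= h j) ->
  lam 0 * S ^+ p.+1 + h 0 * (lam 1 * S ^+ p) <= \det (chain_mx p.+1 S lam h).
Proof.
move=> S0 lam0 h0; rewrite det_chain_mxS lerD2l ler_wpM2l //.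
case: p => [|p]; first by rewrite det_mx11 mxE /= expr0 mulr1.
by rewrite det_chain_mxS lerDl mulr_ge0 ?det_chain_mx_ge0.
Qed.

Lemma sum_chain_mx_row0 (R : realType) (p : nat) (S : int) (lam h : nat -> int)
    (w : 'I_p.+1 -> R) :
  \sum_j w j * (chain_mx p S lam h ord0 j)%:~R = \sum_j w j * (lam j)%:~R.
Proof. by apply: eq_bigr => j _; rewrite mxE. Qed.

Lemma sum_chain_mx_rowS (R : realType) (p : nat) (S : int) (lam h : nat -> int)
    (w : 'I_p.+1 -> R) (k : nat) : (k < p)%N ->
  \sum_j w j * (chain_mx p S lam h (inord k.+1) j)%:~R =
  S%:~R * w (inord k.+1) - (h k)%:~R * w (inord k).
Proof.
move=> kp; have kE : (inord k : 'I_p.+1) = k :> nat by rewrite inordK // ltnW.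
have kSE : (inord k.+1 : 'I_p.+1) = k.+1 :> nat by rewrite inordK.
rewrite (bigD1 (inord k.+1)) //= (bigD1 (inord k)) /=; last first.
  by rewrite -val_eqE /= kE kSE; lia.
rewrite big1 ?addr0 => [|j /andP[j1 j2]]; last first.
  rewrite mxE -val_eqE /= kSE /= (negPf j1) ifN ?mulr0 // eqSS.
  by move: j2; rewrite -val_eqE /= kE.
rewrite !mxE -!val_eqE /= kSE kE /= !eqxx ifN; last by lia.
by rewrite rmorphN; ring.
Qed.

(** lam_j and h_j are the quotient and the remainder of m by s^(p - j), so that
    s^(p - j) lam_j = m - h_j. If s^p divided m, all h_j would vanish, the
    coordinates w_1, ..., w_p of a kernel element would range freely over the
    S-torsion of the circle and the equation sum_j lam_j w_j = 0 would determine
    lam_0 w_0; the h_j correct for the general case. *)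
Definition digit_mx (p s m S : nat) : 'M[int]_p.+1 :=
  chain_mx p S%:Z (fun j => (m %/ s ^ (p - j))%N%:Z)
                  (fun j => (m %% s ^ (p - j))%N%:Z).

(** The first row of the matrix yields the integer b = sum_j lam_j w_j, taken as the
    last digit v_p; the other rows yield the steps of a carry chain. *)
Lemma digit_mx_short (R : realType) (p s m r : nat) (x : R) :
  (1 < s)%N -> (r < s)%N -> (s * (p.+1 * (s ^ p) ^ 2) <= m)%N ->
  (s * m + r)%:R + 1 <= s%:R * x ->
  forall w : 'I_p.+1 -> R, (forall j, `|w j| < x^-1) ->
    (forall i, \sum_j w j * (digit_mx p s m (s * m + r) i j)%:~R
               \is a Num.int) ->
    forall j, w j = 0.
Proof.
move=> s1 rs Cm Sx w wx wint.
set S := (s * m + r)%N in Sx wint.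
pose lam j := (m %/ s ^ (p - j))%N; pose h j := (m %% s ^ (p - j))%N.
have s0 : 0 < s%:R :> R by rewrite ltr0n ltnW.
have x0 : 0 < x.
  have : 0 < s%:R * x by apply: lt_le_trans Sx; rewrite ltr_wpDl.
  by rewrite pmulr_rgt0.
pose y j := x * w (inord j).
pose b := \sum_j w j * (lam j)%:R.
pose c j := S%:R * w (inord j.+1) - (h j)%:R * w (inord j).
have b_int : b \is a Num.int.
  by have := wint ord0; rewrite sum_chain_mx_row0.
have c_int j : (j < p)%N -> c j \is a Num.int.
  by move=> jp; have := wint (inord j.+1); rewrite sum_chain_mx_rowS.
(* Digits are computed from the last one down, v_j = s v_(j+1) - c_j, so that
   they are integers; u lists them in reverse. *)
pose u := fix u i := if i is i'.+1 then s%:R * u i' - c (p - i)%N else b.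
have u_int i : (i <= p)%N -> u i \is a Num.int.
  elim: i => [|i IH] ip //=.
  apply: rpredB; last by apply: c_int; lia.
  by apply: rpredM; [exact: natr_int | apply: IH; lia].
pose v j := u (p - j)%N.
have vy : carry_chain p s%:R S%:R x (fun j => (h j)%:R) y v.
  move=> j jp; have -> : v j = s%:R * v j.+1 - c j.
    rewrite /v (_ : (p - j = (p - j.+1).+1)%N); last by lia.
    by rewrite /= (_ : (p - (p - j.+1).+1 = j)%N) //; lia.
  by rewrite /y /c; ring.
have yE : forall j, (j <= p)%N -> y j = 0.
  have SE : S%:R = s%:R * m%:R + r%:R :> R by rewrite natrD natrM.
  rewrite SE in Sx vy.
  apply: (@carry_chain_short_eq0 R p s%:R m%:R r%:R x _ y v _ _ _ _ _ vy) => //.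
  - by rewrite ler_nat.
  - by rewrite ler0n /= lerBrDr natr1 ler_nat.
  - by rewrite -!natrX -!natrM ler_nat.
  - move=> j jp; rewrite ler0n -natrX ler_nat /= /h.
    apply: leq_trans (ltnW (ltn_pmod _ _)) _; first by rewrite expn_gt0 ltnW.
    by rewrite leq_exp2l // leq_subr.
  - by move=> j jp; apply: u_int; exact: leq_subr.
  - move=> j jp; rewrite /y normrM gtr0_norm // -(mulfV (lt0r_neq0 x0)).
    by rewrite ltr_pM2l.
  (* The telescoped chain, s^p b and s^(p-j) lam_j = m - h_j combine into an
     equation where the h_j cancel: the first row of the dense matrix. *)
  - have E := carry_chain_sum vy.
    have xb : x * v p = \sum_(j < p.+1) y j * (lam j)%:R.
      rewrite /v subnn /= /b mulr_sumr; apply: eq_bigr => j _.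
      by rewrite /y inord_val mulrA.
    have sl j : (j <= p)%N ->
        s%:R ^+ p * (lam j)%:R = s%:R ^+ j * (m%:R - (h j)%:R) :> R.
      move=> jp; rewrite -{1}(subnKC jp) exprD -mulrA; congr (_ * _).
      by rewrite [X in X%:R - _](divn_eq m (s ^ (p - j))) -/(lam j) -/(h j)
        natrD natrM natrX addrK mulrC.
    have xv : x * (s%:R ^+ p * v p) =
        \sum_(j < p.+1) s%:R ^+ j * (m%:R - (h j)%:R) * y j.
      rewrite mulrCA xb mulr_sumr; apply: eq_bigr => j _.
      by rewrite -(sl _ (ltnSE (ltn_ord j))) mulrCA mulrC.
    have hp : h p = 0%N by rewrite /h subnn expn0 modn1.
    have split1 : \sum_(j < p.+1) s%:R ^+ j * (m%:R - (h j)%:R) * y j =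
        m%:R * (\sum_(j < p.+1) s%:R ^+ j * y j) -
        \sum_(j < p) s%:R ^+ j * ((h j)%:R * y j).
      rewrite [X in _ = _ - X](_ : _ =
        \sum_(j < p.+1) s%:R ^+ j * ((h j)%:R * y j)); last first.
        by rewrite big_ord_recr /= hp mul0r mulr0 addr0.
      by rewrite mulr_sumr -sumrB; apply: eq_bigr => j _; ring.
    have split2 : \sum_(j < p.+1) s%:R ^+ j * y j =
        y 0%N + s%:R * \sum_(j < p) s%:R ^+ j * y j.+1.
      rewrite big_ord_recl /= expr0 mul1r mulr_sumr; congr (_ + _).
      by apply: eq_bigr => j _; rewrite /bump /= add1n exprS mulrA.
    rewrite mulrBr xv split1 split2 in E.
    move: E; move: (\sum_(j < p) _ * y _) => Y.
    by move: (\sum_(j < p) _) => e E; lra.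
move=> j; have := yE j; rewrite /y inord_val -ltnS ltn_ord => /(_ isT)/eqP.
by rewrite mulf_eq0 (gt_eqF x0) /= => /eqP.
Qed.

(** With X = S / s, the two leading terms of the determinant add up to
    X^q (X m - h_0 (X - m + h_1)), where X - m < 1 and h_0, h_1 <= s^p: the large
    multiples of h_0 have cancelled. A term lam_0 S^p alone would lose a factor
    1 - h_0 / m, which is too much for the limit. *)
Lemma det_digit_mx_ge (R : realType) (q s m r : nat) :
  let p := q.+1 in let S := (s * m + r)%N in
  let X := S%:R / s%:R : R in
  (1 < s)%N -> (r < s)%N -> (s * (p.+1 * (s ^ p) ^ 2) <= m)%N ->
  X ^+ p * (X - 2) <= (`|\det (digit_mx p s m S)|%N)%:R.
Proof.
move=> p S X s1 rs Cm.
pose lam j := (m %/ s ^ (p - j))%N; pose h j := (m %% s ^ (p - j))%N.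
have s0 : 0 < s%:R :> R by rewrite ltr0n ltnW.
have D := @det_chain_mx_ge q S%:Z (fun j => (lam j)%:Z) (fun j => (h j)%:Z)
  isT (fun=> isT) (fun=> isT).
have XE : X = m%:R + r%:R / s%:R.
  by rewrite /X /S natrD natrM mulrDl mulrC mulKf // lt0r_neq0.
have rs1 : 0 <= (r%:R / s%:R : R) <= 1.
  by apply/andP; split; [rewrite divr_ge0 | rewrite ler_pdivrMr // mul1r ler_nat ltnW].
have SX : S%:R = s%:R * X :> R by rewrite /X mulrC divfK // lt0r_neq0.
have lamE j : s%:R ^+ (p - j) * (lam j)%:R = m%:R - (h j)%:R :> R.
  rewrite [X in X%:R - _](divn_eq m (s ^ (p - j))) -/(lam j) -/(h j).
  by rewrite natrD natrM natrX addrK mulrC.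
have hle j : (h j)%:R <= s%:R ^+ p :> R.
  rewrite -natrX ler_nat; apply: leq_trans (ltnW (ltn_pmod _ _)) _.
    by rewrite expn_gt0 ltnW.
  by rewrite leq_exp2l // leq_subr.
rewrite natr_absz; apply: le_trans (_ : (\det (digit_mx p s m S))%:~R <= _);
  last by rewrite ler_int ler_norm.
move: D; rewrite -(ler_int R) rmorphD !rmorphM !rmorphXn /= => D.
apply: le_trans D; rewrite -/p -!pmulrn SX.
have -> : (lam 0%N)%:R * (s%:R * X) ^+ p = X ^+ q * (X * (m%:R - (h 0%N)%:R)).
  by rewrite -lamE subn0 exprMn [X ^+ p]exprS; ring.
have -> : (lam 1%N)%:R * (s%:R * X) ^+ q = X ^+ q * (m%:R - (h 1%N)%:R).
  by rewrite -lamE /p subn1 exprMn /=; ring.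
rewrite [Z in _ <= _ + Z]mulrCA -mulrDr [X ^+ p]exprSr -mulrA.
have G1 : 1 <= s%:R ^+ p :> R by rewrite exprn_ege1 // ler1n ltnW.
have CmR : s%:R * (p.+1%:R * (s%:R ^+ p) ^+ 2) <= m%:R :> R.
  by rewrite -!natrX -!natrM ler_nat.
have s2 : 2 <= s%:R :> R by rewrite ler_nat.
have p1 : 1 <= p.+1%:R :> R by rewrite ler1n.
have h0 : 0 <= (h 0%N)%:R :> R by [].
have h1 : 0 <= (h 1%N)%:R :> R by [].
have := hle 0%N; have := hle 1%N.
move: rs1; rewrite XE => /andP[]; move: (r%:R / s%:R) => f.
move: (s%:R ^+ p) G1 CmR => G G1 CmR.
have GG : 2 * G ^+ 2 <= m%:R.
  apply: le_trans CmR; apply: ler_pM; rewrite ?exprn_ge0 //; try lra.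
  by rewrite ler_peMl // sqr_ge0.
move: h0 h1; move: ((h 0%N)%:R) ((h 1%N)%:R) => a b a0 b0 f0 f1 bG aG.
rewrite ler_wpM2l ?exprn_ge0 //; first by rewrite addr_ge0.
rewrite expr2 in GG; nra.
Qed.

(** * The limit *)

Lemma exprD_ge (R : realType) (p : nat) (X e : R) : 0 <= X -> 0 <= e ->
  X ^+ p * (X + p.+1%:R * e) <= (X + e) ^+ p.+1.
Proof.
move=> X0 e0; elim: p => [|p IH]; first by rewrite expr0 expr1 !mul1r.
rewrite [leRHS]exprS; apply: (@le_trans _ _ ((X + e) * (X ^+ p * (X + p.+1%:R * e)))).
  rewrite mulrCA exprSr -mulrA ler_wpM2l ?exprn_ge0 // -[p.+2%:R]natr1.
  have : 0 <= p.+1%:R * (e * e) :> R by rewrite !mulr_ge0.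
  by move: (p.+1%:R) => P; nra.
by rewrite ler_wpM2l // addr_ge0.
Qed.

(** Bernoulli's inequality bounds powers of X - e only from below; applied to X + e
    it gives an upper bound, because (X - e) (X + e) <= X ^ 2. *)
Lemma exprB_le (R : realType) (p : nat) (X e : R) :
  4 <= X -> 0 <= e <= X -> 4 <= p.+1%:R * e ->
  (X - e) ^+ p.+1 <= X ^+ p * (X - 2).
Proof.
move=> X4 /andP[e0 eX] pe.
have X0 : 0 < X by lra.
have Xp : 0 < X ^+ p by rewrite exprn_gt0.
have B := exprD_ge p (ltW X0) e0.
have le1 : (X - e) ^+ p.+1 * (X + e) ^+ p.+1 <= X ^+ p * X * (X ^+ p * X).
  rewrite -!exprSr -!exprMn; apply: lerXn2r; rewrite ?nnegrE; nra.
have le2 : (X - e) ^+ p.+1 * (X ^+ p * (X + p.+1%:R * e)) <=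
    X ^+ p * X * (X ^+ p * X).
  by apply: le_trans le1; rewrite ler_wpM2l // exprn_ge0 // subr_ge0.
have Xe : 0 < X + p.+1%:R * e by lra.
rewrite -(ler_pM2r (mulr_gt0 Xp Xe)); apply: le_trans le2 _.
rewrite -mulrA -[leRHS]mulrA ler_wpM2l ?(ltW Xp) //.
rewrite mulrCA [leRHS]mulrCA ler_wpM2l ?(ltW Xp) //.
by move: pe; move: (p.+1%:R * e) => q q4; nra.
Qed.

Lemma Theta_grp_ge (R : realType) (n : nat) (x e D : R) : (1 <= n)%N ->
  0 <= x - e -> (x - e) ^+ n <= D ->
  (D%:E <= alpha_grp R (strong_pow (circle_graph x) n))%E ->
  ((x - e)%:E <= Theta_grp R (circle_graph x))%E.
Proof.
move=> n1 xe xD Da.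
have nR : n%:R != 0 :> R by rewrite pnatr_eq0 -lt0n.
apply: (@le_trans _ _ (alpha_grp R (strong_pow (circle_graph x) n) `^ n%:R^-1)%E);
  last by apply: ereal_sup_ubound; exists n.
have -> : (x - e)%:E = (((x - e) ^+ n)%:E `^ n%:R^-1)%E :> \bar R.
  by rewrite poweR_EFin -powR_mulrn // -powRrM mulfV // powRr1.
apply: gt0_ler_poweR; rewrite ?invr_ge0 //.
- by rewrite in_itv /= lee_fin exprn_ge0 // leey.
- by rewrite in_itv /= alpha_grp_ge0 leey.
- by apply: le_trans Da; rewrite lee_fin.
Qed.

(** With s and p fixed by e, every large x is within 2 / s of some S / s for which
    the kernel of [digit_mx] is independent. *)
Lemma Theta_grp_ge_eventually (R : realType) (e : R) : 0 < e ->
  exists x0 : R, forall x, x0 <= x ->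
    ((x - e)%:E <= Theta_grp R (circle_graph x))%E.
Proof.
move=> e0.
(* Rounding x to S / s costs 2 / s, and the p + 1 st root costs about
   2 / (p + 1); s and p make each at most e / 2. *)
pose s := (Num.truncn (4 / e)).+2; pose q := Num.truncn (8 / e).
pose p := q.+1.
have s4 : 2 / s%:R <= e / 2.
  have : 4 / e < s%:R by apply: lt_le_trans (truncnS_gt _) _; rewrite ler_nat.
  rewrite ltr_pdivrMr // => se; rewrite ler_pdivrMr ?ltr0n //; nra.
have pe : 4 <= p.+1%:R * (e / 2).
  have : 8 / e < p.+1%:R by apply: lt_le_trans (truncnS_gt _) _; rewrite ler_nat.
  by rewrite ltr_pdivrMr // => ?; lra.
have s1 : (1 < s)%N by [].
have s2 : 2 <= s%:R :> R by rewrite ler_nat.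
clearbody s q.
pose C := (s * (p.+1 * (s ^ p) ^ 2))%N.
exists (C%:R + e + 6) => x xC.
have C0 : 0 <= C%:R :> R by [].
have x0 : 0 < x by lra.
(* The predecessor leaves the slack S + 1 <= s x. *)
pose S := (Num.truncn (s%:R * x)).-1.
have sx2 : 2 <= s%:R * x by nra.
have Sx : S%:R + 1 <= s%:R * x.
  rewrite natr1 prednK; first by rewrite truncn_le; nra.
  by rewrite truncn_gt0; lra.
have xS : s%:R * x <= S%:R + 2.
  have : (Num.truncn (s%:R * x) <= S + 1)%N by rewrite /S; lia.
  rewrite -(ler_nat R) natrD => h; have := truncnS_gt (s%:R * x).
  by rewrite -natr1; lra.
have SE : S = (s * (S %/ s) + S %% s)%N by rewrite mulnC -divn_eq.
have rs : (S %% s < s)%N by rewrite ltn_pmod // ltnW.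
have sR : 0 < s%:R :> R by lra.
have CmS : (C <= S %/ s)%N.
  rewrite leq_divRL ?(ltnW s1) // -(ler_nat R) natrM; nra.
move: (S %/ s)%N (S %% s)%N SE rs CmS => m r SE rs CmS.
clearbody S; subst S.
have D := @det_digit_mx_ge R q s m r s1 rs CmS.
set X := (s * m + r)%N%:R / s%:R in D.
have Xx : x - e / 2 <= X.
  rewrite ler_pdivlMr //.
  have : 2 <= s%:R * (e / 2) by move: s4; rewrite ler_pdivrMr // mulrC.
  by nra.
have X2 := exprB_le (e := e / 2) (p := p) (X := X).
apply: (@Theta_grp_ge R p.+1 x e (`|\det (digit_mx p s m (s * m + r))|%N)%:R) => //.
- by lra.
- apply: le_trans D; apply: le_trans (X2 _ _ pe); try lra.
  by apply: lerXn2r; rewrite ?nnegrE; lra.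
- apply: alpha_grp_kernel_ge => //; last exact: digit_mx_short.
  rewrite -absz_gt0 -(ltr_nat R); apply: lt_le_trans D.
  by rewrite mulr_gt0 ?exprn_gt0 //; lra.
Qed.

Theorem theorem1p6 (R : realType) :
  (x%:E - Theta_grp R (circle_graph x))%E @[x --> +oo] --> 0%E.
Proof.
have ThetaE (e : R) : 0 < e -> \forall x \near +oo,
    exists2 t : R, Theta_grp R (circle_graph x) = t%:E & x - e <= t <= x.
  move=> e0; have [x0 x0P] := Theta_grp_ge_eventually e0.
  near=> x.
  have lo : ((x - e)%:E <= Theta_grp R (circle_graph x))%E.
    by apply: x0P; near: x; apply: nbhs_pinfty_ge; exact: num_real.
  have hi : (Theta_grp R (circle_graph x) <= x%:E)%E.
    by apply: Theta_grp_le; near: x; apply: nbhs_pinfty_ge; exact: num_real.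
  case: (Theta_grp R (circle_graph x)) lo hi => [t| |] //.
  by rewrite !lee_fin => lo hi; exists t => //; rewrite lo hi.
apply/fine_cvgP; split.
  by apply: filterS (ThetaE 1 ltr01) => x [t -> _].
apply/cvgrPdist_le => e e0; apply: filterS (ThetaE e e0) => x [t + /andP[lo hi]].
by move=> /= ->; rewrite sub0r normrN /= ger0_norm; lra.
Unshelve. all: by end_near.
Qed.
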